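(* Let $\mathsf{TA}$ be true arithmetic, the set of all sentences in the language of arithmetic $\{0,1,+,\times\}$ true in the standard model $\mathbb{N}$. There is no theory $T$ together with a joint definitional extension $U$ of $T$ and $\mathsf{TA}$ and a computable model $M$ of $T$ such that the arithmetical model corresponding to $M$ (via $U$) is non-standard.
   Context: A computable model of a finite signature is a model whose domain is a computable set of natural numbers and in which the interpretations of all functions and predicates are computable functions and computable sets of tuples. A theory $U$ is a definitional extension of $T$ if the signature of $U$ extends that of $T$, $U$ and $T$ prove the same $T$-sentences, and every new predicate $P(\vec x)$ (resp. function $f(\vec x)$) is $U$-provably equivalent to some $T$-formula $\mathsf{D}_P(\vec x)$ (resp. $U\vdash f(\vec x)=y\leftrightarrow\mathsf{D}_f(\vec x,y)$). Two theories (with signatures made disjoint by renaming if necessary) are definitionally equivalent if some theory, a joint definitional extension, is a definitional extension of both. Given a joint definitional extension $U$ of $T$ and $\mathsf{TA}$, each model $M$ of $T$ expands uniquely to a model of $U$ on the same domain, whose reduct to the arithmetical signature is the arithmetical model corresponding to $M$; it is non-standard if not isomorphic to $\mathbb{N}$. *)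

(* Defs.v *)
(* MathComp world: first-order logic and recursive functions over plain nat. *)
From mathcomp Require Import all_boot.
From Stdlib Require List.

Set Implicit Arguments.
Unset Strict Implicit.
Unset Printing Implicit Defensive.

(** * First-order logic with equality *)

(* Symbols are indexed by their arity, so that signature embeddings preserve
   arities definitionally. *)
Record signature : Type := Signature {
  fsym : nat -> Type;
  psym : nat -> Type
}.

Inductive term (S : signature) : Type :=
| Var of nat
| App n of fsym S n & ('I_n -> term S).
Arguments Var {S} _.

(* De Bruijn indices; the connectives other than falsum, implication and the
   universal quantifier are classical abbreviations. *)
Inductive formula (S : signature) : Type :=
| Bot
| Eq of term S & term S
| Rel n of psym S n & ('I_n -> term S)
| Imp of formula S & formula S
| All of formula S.
Arguments Bot {S}.

Definition Neg S (p : formula S) := Imp p Bot.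
Definition And S (p q : formula S) := Neg (Imp p (Neg q)).
Definition Iff S (p q : formula S) := And (Imp p q) (Imp q p).

Fixpoint tsubst S (s : nat -> term S) (t : term S) : term S :=
  match t with
  | Var x => s x
  | App n f a => App f (fun i => tsubst s (a i))
  end.

Definition shift S : nat -> term S := fun x => Var x.+1.

Definition up S (s : nat -> term S) : nat -> term S :=
  fun x => if x is y.+1 then tsubst (@shift S) (s y) else Var 0.

Fixpoint fsubst S (s : nat -> term S) (p : formula S) : formula S :=
  match p with
  | Bot => Bot
  | Eq t u => Eq (tsubst s t) (tsubst s u)
  | Rel n P a => Rel P (fun i => tsubst s (a i))
  | Imp p q => Imp (fsubst s p) (fsubst s q)
  | All p => All (fsubst (up s) p)
  end.

Definition inst S (t : term S) (p : formula S) : formula S :=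
  fsubst (fun x => if x is y.+1 then Var y else t) p.

(* All free variables are among [Var 0], ..., [Var (k - 1)]. *)
Fixpoint tbounded S (k : nat) (t : term S) : Prop :=
  match t with
  | Var x => x < k
  | App n f a => forall i, tbounded k (a i)
  end.

Fixpoint bounded S (k : nat) (p : formula S) : Prop :=
  match p with
  | Bot => True
  | Eq t u => tbounded k t /\ tbounded k u
  | Rel n P a => forall i, tbounded k (a i)
  | Imp p q => bounded k p /\ bounded k q
  | All p => bounded k.+1 p
  end.

Definition sentence S (p : formula S) : Prop := bounded 0 p.

Record theory (S : signature) : Type := Theory {
  axiom :> formula S -> Prop;
  axiom_sentence : forall p, axiom p -> sentence p
}.

(* Classical natural deduction. *)
Inductive nd (S : signature) : seq (formula S) -> formula S -> Prop :=
| nd_ax G p : List.In p G -> nd G p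
| nd_impI G p q : nd (p :: G) q -> nd G (Imp p q)
| nd_impE G p q : nd G (Imp p q) -> nd G p -> nd G q
| nd_raa G p : nd (Neg p :: G) Bot -> nd G p
| nd_allI G p : nd (map (fsubst (@shift S)) G) p -> nd G (All p)
| nd_allE G p t : nd G (All p) -> nd G (inst t p)
| nd_refl G t : nd G (Eq t t)
| nd_leibniz G p t u : nd G (Eq t u) -> nd G (inst t p) -> nd G (inst u p).

Definition provable S (T : theory S) (p : formula S) : Prop :=
  exists2 G, (forall q, List.In q G -> T q) & nd G p.

(* A structure with domain [A]; predicates are arbitrary (classical)
   relations. *)
Record structure (S : signature) (A : Type) : Type := Structure {
  nonempty : inhabited A;
  fint : forall n, fsym S n -> ('I_n -> A) -> A;
  pint : forall n, psym S n -> ('I_n -> A) -> Prop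
}.

Fixpoint teval S A (M : structure S A) (e : nat -> A) (t : term S) : A :=
  match t with
  | Var x => e x
  | App n f a => fint M f (fun i => teval M e (a i))
  end.

Definition scons A (x : A) (e : nat -> A) : nat -> A :=
  fun k => if k is l.+1 then e l else x.

Fixpoint sat S A (M : structure S A) (e : nat -> A) (p : formula S) : Prop :=
  match p with
  | Bot => False
  | Eq t u => teval M e t = teval M e u
  | Rel n P a => pint M P (fun i => teval M e (a i))
  | Imp p q => sat M e p -> sat M e q
  | All p => forall x, sat M (scons x e) p
  end.

Definition holds S A (M : structure S A) (p : formula S) : Prop :=
  forall e, sat M e p.

Definition is_model S A (M : structure S A) (T : theory S) : Prop :=
  forall p, T p -> holds M p.

Definition isomorphic S A B (M : structure S A) (N : structure S B) : Prop :=
  exists h : A -> B,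
    [/\ bijective h,
        forall n (f : fsym S n) a, h (fint M f a) = fint N f (h \o a)
      & forall n (P : psym S n) a, pint M P a <-> pint N P (h \o a)].

(** * Definitional extensions *)

Record embedding (S S' : signature) : Type := Embedding {
  emf : forall n, fsym S n -> fsym S' n;
  emp : forall n, psym S n -> psym S' n;
  emf_inj : forall n, injective (@emf n);
  emp_inj : forall n, injective (@emp n)
}.

Fixpoint tmap S S' (i : embedding S S') (t : term S) : term S' :=
  match t with
  | Var x => Var x
  | App n f a => App (emf i f) (fun k => tmap i (a k))
  end.

Fixpoint fmap S S' (i : embedding S S') (p : formula S) : formula S' :=
  match p with
  | Bot => Bot
  | Eq t u => Eq (tmap i t) (tmap i u)
  | Rel n P a => Rel (emp i P) (fun k => tmap i (a k))
  | Imp p q => Imp (fmap i p) (fmap i q)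
  | All p => All (fmap i p)
  end.

(* The variables [x] and [y] of the defining formulas are
   [Var 0], ..., [Var (n - 1)] and [Var n]. *)
Definition definitional_extension S S' (i : embedding S S')
    (T : theory S) (U : theory S') : Prop :=
  [/\ forall p, sentence p -> (provable U (fmap i p) <-> provable T p),
      forall n (P : psym S' n), ~ (exists Q, P = emp i Q) ->
        exists2 D : formula S, bounded n D
          & provable U (Iff (Rel P (fun k => Var k)) (fmap i D))
    & forall n (f : fsym S' n), ~ (exists g, f = emf i g) ->
        exists2 D : formula S, bounded n.+1 D
          & provable U (Iff (Eq (App f (fun k => Var k)) (Var n)) (fmap i D))].

(* The embeddings play the role of the renaming that makes the signatures
   disjoint. *)
Definition joint_definitional_extension S1 S2 S (i : embedding S1 S)
    (j : embedding S2 S) (T1 : theory S1) (T2 : theory S2) (U : theory S) :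
    Prop :=
  [/\ forall n (f : fsym S1 n) (g : fsym S2 n), emf i f <> emf j g,
      forall n (P : psym S1 n) (Q : psym S2 n), emp i P <> emp j Q,
      definitional_extension i T1 U
    & definitional_extension j T2 U].

Definition is_reduct S S' A (i : embedding S S')
    (N : structure S' A) (M : structure S A) : Prop :=
  (forall n (f : fsym S n) a, fint M f a = fint N (emf i f) a) /\
  (forall n (P : psym S n) a, pint M P a <-> pint N (emp i P) a).

(* [M2] is the reduct of the (unique) expansion of [M1] to a model of [U] on
   the same domain. *)
Definition corresponding_model S1 S2 S A (i : embedding S1 S)
    (j : embedding S2 S) (U : theory S)
    (M1 : structure S1 A) (M2 : structure S2 A) : Prop :=
  exists N : structure S A,
    [/\ is_model N U, is_reduct i N M1 & is_reduct j N M2].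

(** * True arithmetic *)

Inductive arith_fsym : nat -> Type :=
| AZero : arith_fsym 0
| AOne : arith_fsym 0
| AAdd : arith_fsym 2
| AMul : arith_fsym 2.

Definition arith : signature := Signature arith_fsym (fun _ => Empty_set).

Definition arith_fint n (f : arith_fsym n) : ('I_n -> nat) -> nat :=
  match f in arith_fsym m return ('I_m -> nat) -> nat with
  | AZero => fun _ => 0
  | AOne => fun _ => 1
  | AAdd => fun a => a ord0 + a ord_max
  | AMul => fun a => a ord0 * a ord_max
  end.

Definition standard_model : structure arith nat :=
  @Structure arith nat (inhabits 0) arith_fint (fun n P _ => match P with end).

Definition TA : theory arith :=
  @Theory arith (fun p => sentence p /\ holds standard_model p)
    (fun p H => proj1 H).

Definition nonstandard A (M : structure arith A) : Prop :=
  ~ isomorphic M standard_model.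

(** * Computable models *)

Inductive recfun : nat -> Type :=
| RZero : recfun 0
| RSucc : recfun 1
| RProj n : 'I_n -> recfun n
| RComp k n : recfun k -> ('I_k -> recfun n) -> recfun n
| RPrec n : recfun n -> recfun n.+2 -> recfun n.+1
| RMu n : recfun n.+1 -> recfun n.

Definition vcons A n (x : A) (v : 'I_n -> A) : 'I_n.+1 -> A :=
  fun i => if unlift ord0 i is Some k then v k else x.

Definition vtail A n (v : 'I_n.+1 -> A) : 'I_n -> A :=
  fun i => v (lift ord0 i).

(* [reval c v y]: the partial recursive function with code [c] is defined at
   [v] with value [y].  Recursion is on the first argument, and [s] lists its
   successive values. *)
Fixpoint reval n (c : recfun n) : ('I_n -> nat) -> nat -> Prop :=
  match c in recfun m return ('I_m -> nat) -> nat -> Prop with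
  | RZero => fun _ y => y = 0
  | RSucc => fun v y => y = (v ord0).+1
  | RProj _ i => fun v y => y = v i
  | RComp k _ g h => fun v y =>
      exists2 w : 'I_k -> nat, (forall i, reval (h i) v (w i)) & reval g w y
  | RPrec _ f g => fun v y =>
      exists s : nat -> nat,
        [/\ reval f (vtail v) (s 0),
            forall k, k < v ord0 ->
              reval g (vcons k (vcons (s k) (vtail v))) (s k.+1)
          & y = s (v ord0)]
  | RMu _ f => fun v y =>
      reval f (vcons y v) 0 /\
      forall k, k < y -> exists z, reval f (vcons k v) z.+1
  end.

Definition computable_set n (X : ('I_n -> nat) -> Prop) : Prop :=
  exists c : recfun n,
    forall v, (X v -> reval c v 1) /\ (~ X v -> reval c v 0).

Definition finite_signature (S : signature) : Prop :=
  (exists s : seq {n & fsym S n}, forall f, List.In f s) /\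
  (exists s : seq {n & psym S n}, forall P, List.In P s).

(* A function on the domain is computable if it is the restriction of a partial
   recursive function; as the domain is a computable set, this is the same as
   being the restriction of a total recursive one. *)
Definition computable_model S (D : pred nat)
    (M : structure S {x : nat | D x}) : Prop :=
  [/\ finite_signature S,
      computable_set (fun v : 'I_1 -> nat => D (v ord0)),
      forall n (f : fsym S n), exists c : recfun n,
        forall a, reval c (fun k => val (a k)) (val (fint M f a))
    & forall n (P : psym S n),
        computable_set (fun v : 'I_n -> nat =>
          exists2 a : 'I_n -> {x : nat | D x},
            (forall k, v k = val (a k)) & pint M P a)].

(* Main.v *)
Require Import Defs.
From mathcomp Require Import all_boot zify.
From Stdlib Require Import Classical FunctionalExtensionality IndefiniteDescription.

(* If M is computable, every relation definable in M is arithmetical.  As A is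
   definable in M, the satisfaction in A of any fixed arithmetical formula is
   an arithmetical relation between natural numbers.  But A is a nonstandard
   model of true arithmetic, so every arithmetical set X of naturals is coded
   by beta-function parameters a, b of A, in the sense that n is in X iff
   A |= beta(a, b, n) = 0.  The domain of A consists of naturals, so one can
   diagonalize against the code: the set of those m = <a, b> for which
   A |= beta(a, b, m) <> 0 is arithmetical, but cannot be coded. *)

Set Implicit Arguments.
Unset Strict Implicit.
Unset Printing Implicit Defensive.

(** * Substitution, soundness, reducts and universal closures *)

Lemma teval_subst S A (M : structure S A) s e t :
  teval M e (tsubst s t) = teval M (fun k => teval M e (s k)) t.
Proof.
elim: t => [x|n f a IH] //=; congr (fint M f _).
by apply: functional_extensionality => i; apply: IH.
Qed.

Lemma teval_up S A (M : structure S A) s e x :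
  (fun k => teval M (scons x e) (up s k)) =
  scons x (fun k => teval M e (s k)).
Proof. by apply: functional_extensionality => -[|k] //=; rewrite teval_subst. Qed.

Lemma sat_subst S A (M : structure S A) p : forall s e,
  sat M e (fsubst s p) <-> sat M (fun k => teval M e (s k)) p.
Proof.
elim: p => [|t u|n P a|p IHp q IHq|p IH] s e //=.
- by rewrite !teval_subst.
- suff -> : (fun i => teval M e (tsubst s (a i))) =
    (fun i => teval M (fun k => teval M e (s k)) (a i)) by [].
  by apply: functional_extensionality => i; rewrite teval_subst.
- by rewrite IHp IHq.
- by split=> H x; move: (H x); rewrite IH teval_up.
Qed.

Lemma sat_inst S A (M : structure S A) e t p :
  sat M e (inst t p) <-> sat M (scons (teval M e t) e) p.
Proof.
rewrite sat_subst; suff -> : (fun k => teval M e match k with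
  | 0 => t | y.+1 => Var y end) = scons (teval M e t) e by [].
by apply: functional_extensionality => -[].
Qed.

Lemma nd_sound S A (M : structure S A) G p : nd G p ->
  forall e, (forall q, List.In q G -> sat M e q) -> sat M e p.
Proof.
elim=> {G p} [G p Hp|G p q _ IH|G p q _ IH1 _ IH2|G p _ IH|G p _ IH|G p t _ IH
  |G t|G p t u _ IH1 _ IH2] e HG //=.
- exact: HG.
- by move=> Hp; apply: IH => r /= [<-|/HG].
- exact: (IH1 e HG (IH2 e HG)).
- apply: NNPP => np; apply: (IH e) => r /= [<-|/HG] //.
- move=> x; apply: IH => r /List.in_map_iff [q [<- Hq]].
  by apply/sat_subst; apply: HG.
- by apply/sat_inst; apply: (IH e HG).
- by apply/sat_inst; rewrite -(IH1 e HG : _ = _); apply/sat_inst; apply: IH2.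
Qed.

Lemma provable_sound S A (M : structure S A) (T : theory S) p :
  is_model M T -> provable T p -> holds M p.
Proof. by move=> HM [G HG Hp] e; apply: (nd_sound Hp) => q /HG /HM. Qed.

Lemma sat_iff S A (M : structure S A) e p q :
  sat M e (Iff p q) <-> (sat M e p <-> sat M e q).
Proof. by rewrite /=; case: (classic (sat M e p)); case: (classic (sat M e q)); tauto. Qed.

Definition Ex S (p : formula S) := Neg (All (Neg p)).

Lemma sat_ex S A (M : structure S A) e p :
  sat M e (Ex p) <-> exists x, sat M (scons x e) p.
Proof.
split=> [H|[x Hx] H]; last exact: (H x Hx).
by apply: NNPP => nH; apply: H => x Hx; apply: nH; exists x.
Qed.

Lemma teval_reduct S S' A (i : embedding S S') (N : structure S' A) M e t :
  is_reduct i N M -> teval N e (tmap i t) = teval M e t.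
Proof.
case=> Hf _; elim: t => [x|n f a IH] //=; rewrite Hf; congr (fint N _ _).
exact: functional_extensionality.
Qed.

Lemma sat_reduct S S' A (i : embedding S S') (N : structure S' A) M p :
  is_reduct i N M -> forall e, sat N e (fmap i p) <-> sat M e p.
Proof.
move=> HR; elim: p => [|t u|n P a|p IHp q IHq|p IH] e //=.
- by rewrite !(teval_reduct _ _ HR).
- rewrite HR.2; suff -> : (fun k => teval N e (tmap i (a k))) =
    (fun k => teval M e (a k)) by [].
  by apply: functional_extensionality => k; rewrite (teval_reduct _ _ HR).
- by rewrite IHp IHq.
- by split=> H x; apply/IH.
Qed.

Lemma tbounded_mono S k l (t : term S) : k <= l -> tbounded k t -> tbounded l t.
Proof.
move=> kl; elim: t => [x|n f a IH] /=; first by move/leq_trans; apply.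
by move=> H i; apply: IH.
Qed.

Lemma bounded_mono S (p : formula S) : forall k l,
  k <= l -> bounded k p -> bounded l p.
Proof.
elim: p => [|t u|n P a|p IHp q IHq|p IH] k l kl //=.
- by case=> /(tbounded_mono kl) Ht /(tbounded_mono kl).
- by move=> H i; apply: tbounded_mono (H i).
- by case=> /(IHp _ _ kl) Hp /(IHq _ _ kl).
- exact: IH.
Qed.

Lemma tvec_bounded_ex S n (a : 'I_n -> term S) :
  (forall i, exists k, tbounded k (a i)) ->
  exists k, forall i, tbounded k (a i).
Proof.
case/fin_all_exists => k Hk; exists (\max_i k i) => i.
by apply: tbounded_mono (Hk i); apply: leq_bigmax.
Qed.

Lemma tbounded_ex S (t : term S) : exists k, tbounded k t.
Proof.
elim: t => [x|n f a IH]; first by exists x.+1 => /=.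
exact: tvec_bounded_ex.
Qed.

Lemma bounded_ex S (p : formula S) : exists k, bounded k p.
Proof.
elim: p => [|t u|n P a|p [k Hp] q [l Hq]|p [k Hk]].
- by exists 0.
- have [k Hk] := tbounded_ex t; have [l Hl] := tbounded_ex u.
  by exists (maxn k l); split; [apply: tbounded_mono Hk|apply: tbounded_mono Hl];
    rewrite leq_max leqnn ?orbT.
- by apply: tvec_bounded_ex => i; apply: tbounded_ex.
- by exists (maxn k l); split; [apply: bounded_mono Hp|apply: bounded_mono Hq];
    rewrite leq_max leqnn ?orbT.
- by exists k; apply: bounded_mono Hk.
Qed.

Lemma bounded_closure S k (p : formula S) :
  bounded k p -> sentence (iter k (@All S) p).
Proof.
rewrite /sentence; elim: k p => [|k IH] p // H.
by rewrite iterSr; apply: IH.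
Qed.

Lemma scons_eta A (e : nat -> A) : scons (e 0) (fun k => e k.+1) = e.
Proof. by apply: functional_extensionality => -[]. Qed.

Lemma holds_closure S A (M : structure S A) k p :
  holds M (iter k (@All S) p) <-> holds M p.
Proof.
elim: k => [|k IH] //; rewrite -IH /=; split=> H e; last by move=> x; apply: H.
by rewrite -(scons_eta e); apply: H.
Qed.

(** [TA] contains only sentences, so a formula with free variables is transferred from the standard
    model through its universal closure. *)
Lemma TA_model_holds A (M : structure arith A) p :
  is_model M TA -> holds standard_model p -> holds M p.
Proof.
move=> HM Hp; have [k Hk] := bounded_ex p.
apply/(holds_closure _ k); apply: HM; split; first exact: bounded_closure.
exact/holds_closure.
Qed.

(** * First-order closed classes of relations *)

(* Relations are predicates of infinite environments, so that de Bruijn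
   formulas over any structure can be interpreted in the class. *)
Record fo_class A (K : ((nat -> A) -> Prop) -> Prop) : Prop := FoClass {
  fo_ext : forall P Q, (forall e, P e <-> Q e) -> K P -> K Q;
  fo_bot : K (fun _ => False);
  fo_imp : forall P Q, K P -> K Q -> K (fun e => P e -> Q e);
  fo_all : forall P, K (fun e => P (e 0) (fun k => e k.+1)) ->
    K (fun e => forall x, P x e);
  fo_ren : forall P (g : nat -> nat), K P -> K (fun e => P (fun k => e (g k)));
  fo_eq : forall x y, K (fun e => e x = e y)
}.

Lemma fo_not A K : @fo_class A K -> forall P, K P -> K (fun e => ~ P e).
Proof. by move=> HK P HP; apply: (fo_imp HK HP (fo_bot HK)). Qed.

Lemma fo_and A K : @fo_class A K ->
  forall P Q, K P -> K Q -> K (fun e => P e /\ Q e).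
Proof.
move=> HK P Q HP HQ.
apply: (fo_ext HK _ (fo_not HK (fo_imp HK HP (fo_not HK HQ)))) => e; split.
  by move=> H; split; apply: NNPP => H'; apply: H.
by case=> p q /(_ p q).
Qed.

Lemma fo_ex A K : @fo_class A K -> forall P,
  K (fun e => P (e 0) (fun k => e k.+1)) -> K (fun e => exists x, P x e).
Proof.
move=> HK P HP.
apply: (fo_ext HK _ (fo_not HK (fo_all HK (P := fun x e => ~ P x e) _))).
  move=> e; split; last by case=> x Hx /(_ x Hx).
  by move=> H; apply: NNPP => H'; apply: H => x Hx; apply: H'; exists x.
exact: (fo_not HK HP).
Qed.

Lemma fo_forall_ord A K : @fo_class A K -> forall n (P : 'I_n -> _ -> Prop),
  (forall i, K (P i)) -> K (fun e => forall i, P i e).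
Proof.
move=> HK n P HP.
suff HS (s : seq 'I_n) : K (fun e => forall i, i \in s -> P i e).
  by apply: (fo_ext HK _ (HS (enum 'I_n))) => e; split=> H i *; apply: H;
    rewrite ?mem_enum.
elim: s => [|j s IH].
  by apply: (fo_ext HK _ (fo_imp HK (fo_bot HK) (fo_bot HK))) => e; split.
apply: (fo_ext HK _ (fo_and HK (HP j) IH)) => e; split.
  by case=> Hj Hs i; rewrite inE => /orP[/eqP->|/Hs].
by move=> H; split=> [|i Hi]; apply: H; rewrite inE ?eqxx ?Hi ?orbT.
Qed.

Lemma fo_ex_vec A K : @fo_class A K -> forall n (P : ('I_n -> A) -> _ -> Prop),
  K (fun e => P (fun i => e i) (fun k => e (n + k))) ->
  K (fun e => exists w, P w e).
Proof.
move=> HK n P HP.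
(* The vector is replaced by an infinite sequence of which only the first [m] values are read, so
   that the induction on [m] involves no dependent types. In the successor case the new variable
   fills slot [m]. *)
have key m (Q : (nat -> A) -> Prop) : K Q ->
    K (fun e => exists w : nat -> A, Q (fun k => if k < m then w k else e (k - m))).
  move=> HQ; elim: m => [|m IH].
    apply: (fo_ext HK _ HQ) => e; have E w : (fun k => if k < 0 then w k else e (k - 0)) = e.
      by apply: functional_extensionality => k; rewrite subn0.
    by split=> [H|[w]]; [exists e|]; rewrite E.
  have := fo_ex HK (P := fun x e => exists w, Q (fun k =>
    if k < m then w k else scons x e (k - m))).
  have -> : (fun e : nat -> A => exists w, Q (fun k =>
      if k < m then w k else scons (e 0) (fun k => e k.+1) (k - m))) =
    (fun e => exists w, Q (fun k => if k < m then w k else e (k - m))).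
    by apply: functional_extensionality => e; rewrite scons_eta.
  move=> /(_ IH); apply: (fo_ext HK) => e; split.
    case=> x [w Hw]; exists (fun k => if k < m then w k else x).
    rewrite (_ : (fun k => _) = fun k => if k < m then w k else scons x e (k - m)) //.
    apply: functional_extensionality => k; rewrite ltnS.
    case: ltngtP => // [km|->]; last by rewrite subnn.
    by rewrite -(subnSK km).
  case=> w Hw; exists (w m), w.
  rewrite (_ : (fun k => _) = fun k => if k < m.+1 then w k else e (k - m.+1)) //.
  apply: functional_extensionality => k; rewrite ltnS.
  case: ltngtP => // [km|->]; last by rewrite subnn.
  by rewrite -(subnSK km).
apply: (fo_ext HK _ (key n _ HP)) => e.
have E : (fun k => if n + k < n then e 0 else e (n + k - n)) = e.
  by apply: functional_extensionality => k; rewrite ltnNge leq_addr addKn.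
split=> [[w Hw]|[w Hw]].
  exists (fun i => w i); move: Hw; congr P.
    by apply: functional_extensionality => i; rewrite ltn_ord.
  by apply: functional_extensionality => k; rewrite ltnNge leq_addr addKn.
(* The filler [e 0] stands at indices from [n] on, which are never read. *)
exists (fun k => if insub k is Some i then w i else e 0).
move: Hw; congr P.
  by apply: functional_extensionality => i; rewrite ltn_ord valK.
by apply: functional_extensionality => k; rewrite ltnNge leq_addr addKn.
Qed.

(** The class knows only the graphs of the functions, so nested terms are flattened: the values of
    the arguments become an existentially quantified vector. Slot 0 is kept for the value, which
    shifts the variables of the term by one. *)
Lemma fo_teval A K S (M : structure S A) : fo_class K ->
  (forall n (f : Defs.fsym S n), K (fun e => fint M f (fun i => e i) = e n)) ->
  forall t, K (fun e => teval M (fun k => e k.+1) t = e 0).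
Proof.
move=> HK Hf; elim=> [x|n f a IH] /=; first exact: (fo_eq HK).
apply: (fo_ext HK (P := fun e => exists w,
  (forall i, teval M (fun k => e k.+1) (a i) = w i) /\ fint M f w = e 0)).
  move=> e; split=> [[w [Hw <-]]|H]; last by exists (fun i => teval M (fun k => e k.+1) (a i)).
  by congr (fint M f _); apply: functional_extensionality.
apply: (fo_ex_vec HK); apply: (fo_and HK).
  apply: (fo_forall_ord HK) => i.
  (* The vector [w] occupies slots below [n] and slot [n] holds the value of the whole term, so the
     variables of the term begin at [n + 1]. *)
  exact: (fo_ren HK (fun k => if k is k'.+1 then n + k'.+1 else i) (IH i)).
by rewrite addn0; apply: Hf.
Qed.

Lemma fo_sat A K S (M : structure S A) : fo_class K ->
  (forall n (f : Defs.fsym S n), K (fun e => fint M f (fun i => e i) = e n)) ->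
  (forall n (R : psym S n), K (fun e => pint M R (fun i => e i))) ->
  forall p, K (fun e => sat M e p).
Proof.
move=> HK Hf HR; have HT := fo_teval HK Hf.
elim=> [|t u|n R a|p IHp q IHq|p IH] /=.
- exact: (fo_bot HK).
- apply: (fo_ext HK (P := fun e => exists x, teval M e t = x /\ teval M e u = x)).
    by move=> e; split=> [[x [-> ->]]|H] //; exists (teval M e u).
  by apply: (fo_ex HK); apply: (fo_and HK).
- apply: (fo_ext HK (P := fun e => exists w,
    (forall i, teval M e (a i) = w i) /\ pint M R w)).
    move=> e; split=> [[w [Hw]]|H]; last by exists (fun i => teval M e (a i)).
    by congr (pint M R _); apply: functional_extensionality => i; rewrite -Hw.
  apply: (fo_ex_vec HK); apply: (fo_and HK) => //.
  apply: (fo_forall_ord HK) => i.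
  exact: (fo_ren HK (fun k => if k is k'.+1 then n + k' else i) (HT (a i))).
- exact: (fo_imp HK).
- apply: (fo_all HK (P := fun x e => sat M (scons x e) p)).
  by apply: (fo_ext HK _ IH) => e; rewrite scons_eta.
Qed.

(** * Arithmetical relations *)

Definition arithmetical (P : (nat -> nat) -> Prop) :=
  exists p : formula arith, forall e, sat standard_model e p <-> P e.

Definition polynomial (F : (nat -> nat) -> nat) :=
  exists t : term arith, forall e, teval standard_model e t = F e.

(** The argument vector is indexed by the empty type ['I_0], so [Var 0] is a dummy. *)
Definition tzero : term arith := App (S := arith) AZero (fun _ => Var 0).
Definition tone : term arith := App (S := arith) AOne (fun _ => Var 0).
Definition tadd (t u : term arith) : term arith :=
  App (S := arith) AAdd (fun i => if i == ord0 then t else u).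
Definition tmul (t u : term arith) : term arith :=
  App (S := arith) AMul (fun i => if i == ord0 then t else u).

Lemma poly_var x : polynomial (fun e => e x).
Proof. by exists (Var x). Qed.

Lemma poly_add F G : polynomial F -> polynomial G ->
  polynomial (fun e => F e + G e).
Proof. by case=> t Ht [u Hu]; exists (tadd t u) => e; rewrite -Ht -Hu. Qed.

Lemma poly_mul F G : polynomial F -> polynomial G ->
  polynomial (fun e => F e * G e).
Proof. by case=> t Ht [u Hu]; exists (tmul t u) => e; rewrite -Ht -Hu. Qed.

Fixpoint numeral n := if n is m.+1 then tadd (numeral m) tone else tzero.

Lemma teval_numeral n e : teval standard_model e (numeral n) = n.
Proof. by elim: n => //= n ->; rewrite addn1. Qed.

Lemma poly_const n : polynomial (fun _ => n).
Proof. by exists (numeral n) => e; apply: teval_numeral. Qed.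

Lemma poly_succ F : polynomial F -> polynomial (fun e => (F e).+1).
Proof.
move=> HF; have [t Ht] := poly_add HF (poly_const 1).
by exists t => e; rewrite Ht addn1.
Qed.

Lemma poly_ren F (g : nat -> nat) :
  polynomial F -> polynomial (fun e => F (fun k => e (g k))).
Proof. by case=> t Ht; exists (tsubst (fun k => Var (g k)) t) => e; rewrite teval_subst Ht. Qed.

Lemma arithmetical_subst P (F : (nat -> nat) -> nat -> nat) :
  arithmetical P -> (forall k, polynomial (fun e => F e k)) ->
  arithmetical (fun e => P (F e)).
Proof.
case=> p Hp /functional_choice [s Hs]; exists (fsubst s p) => e.
rewrite sat_subst Hp (_ : (fun k => _) = F e) //.
by apply: functional_extensionality.
Qed.

Lemma arithmetical_fo : fo_class arithmetical.
Proof.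
split.
- by move=> P Q PQ [p Hp]; exists p => e; rewrite Hp.
- by exists Bot.
- by move=> P Q [p Hp] [q Hq]; exists (Imp p q) => e /=; rewrite Hp Hq.
- move=> P [p Hp]; exists (All p) => e.
  by split=> H x; apply/(Hp (scons x e)); apply: H.
- by move=> P g HP; apply: (arithmetical_subst HP) => k; apply: poly_var.
- by move=> x y; exists (Eq (Var x) (Var y)).
Qed.

Lemma arithmetical_eq F G : polynomial F -> polynomial G ->
  arithmetical (fun e => F e = G e).
Proof. by case=> t Ht [u Hu]; exists (Eq t u) => e /=; rewrite Ht Hu. Qed.

Lemma arithmetical_lt F G : polynomial F -> polynomial G ->
  arithmetical (fun e => F e < G e).
Proof.
have HK := arithmetical_fo => HF HG.
apply: (fo_ext HK (P := fun e => exists z, F e + z.+1 = G e)).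
  by move=> e; split=> [[z]|H]; [lia|exists (G e - (F e).+1); lia].
apply: (fo_ex HK); apply: arithmetical_eq; last exact: (poly_ren succn).
by apply: poly_add; [exact: (poly_ren succn)|apply/poly_succ/poly_var].
Qed.

(* Goedel's beta function, which enumerates any finite sequence for suitable
   [a] and [b]. *)
Definition beta a b k := a %% (b * k.+1).+1.

Lemma arithmetical_beta Y F G H :
  polynomial Y -> polynomial F -> polynomial G -> polynomial H ->
  arithmetical (fun e => Y e = beta (F e) (G e) (H e)).
Proof.
have HK := arithmetical_fo => HY HF HG HH.
(* The remainder is characterized by the existence of a quotient together with the bound by the
   modulus. *)
apply: (fo_ext HK (P := fun e =>
  (exists q, F e = q * (G e * (H e).+1).+1 + Y e) /\ Y e < (G e * (H e).+1).+1)).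
  move=> e; rewrite /beta; split=> [[[q ->] lt]|->].
    by rewrite modnMDl modn_small.
  by split; [exists (F e %/ (G e * (H e).+1).+1); rewrite -divn_eq|rewrite ltn_pmod].
have HM : polynomial (fun e => (G e * (H e).+1).+1).
  by apply/poly_succ/poly_mul => //; apply: poly_succ.
apply: (fo_and HK); last exact: arithmetical_lt.
apply: (fo_ex HK); apply: arithmetical_eq; first exact: (poly_ren succn).
apply: poly_add; last exact: (poly_ren succn HY).
by apply: poly_mul; [apply: poly_var|exact: (poly_ren succn HM)].
Qed.

(** * Finite sequences coded by the beta function *)

Lemma chinese_sequence (m r : nat -> nat) n :
  (forall i j, i < j < n -> coprime (m i) (m j)) ->
  exists a, forall k, k < n -> a = r k %[mod m k].
Proof.
elim: n => [|n IH] H; first by exists 0.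
case: IH => [i j /andP[ij jn]|a Ha]; first by apply: H; rewrite ij ltnW.
(* The earlier moduli are merged into their product, which is coprime to the new one; the theorem
   for two moduli then adjusts [a]. *)
pose M := \prod_(k < n) m k.
have co : coprime M (m n).
  apply: (big_ind (fun x => coprime x (m n))) => [|x y|i _]; first exact: coprime1n.
    by rewrite coprimeMl => -> ->.
  by apply: H; rewrite ltn_ord /=.
exists (chinese M (m n) a (r n)) => k; rewrite ltnS leq_eqVlt => /orP[/eqP->|kn].
  exact: chinese_modr.
rewrite -Ha // -(modn_dvdm (chinese _ _ _ _) (_ : m k %| M)).
  by rewrite chinese_modl // modn_dvdm // /M (bigD1 (Ordinal kn)) //= dvdn_mulr.
by rewrite /M (bigD1 (Ordinal kn)) //= dvdn_mulr.
Qed.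

Lemma beta_surj (s : nat -> nat) n :
  exists a b, forall k, k < n -> beta a b k = s k.
Proof.
(* A prime dividing the moduli of [i < j] divides [b * (j - i)] but not [b], hence divides [j - i];
   being at most [N], it divides [N!] after all. The maximum in [N] makes every [s k] smaller than
   its modulus. *)
pose N := n + \max_(k < n) s k; pose b := N`!.
have [|a Ha] := chinese_sequence (m := fun k => (b * k.+1).+1) s (n := n).
  move=> i j /andP[ij jn]; rewrite /coprime; apply/negPn/negP => g1.
  set g := gcdn _ _ in g1.
  have g_gt0 : 0 < g by rewrite gcdn_gt0.
  have [p p_pr pg] : exists2 p, prime p & p %| g.
    by exists (pdiv g); rewrite ?pdiv_dvd ?pdiv_prime //; lia.
  have pi : p %| (b * i.+1).+1 := dvdn_trans pg (dvdn_gcdl _ _).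
  have pj : p %| (b * j.+1).+1 := dvdn_trans pg (dvdn_gcdr _ _).
  have npb : ~~ (p %| b).
    apply/negP => pb; move: pi; rewrite -addn1 dvdn_addr ?dvdn_mulr // dvdn1.
    by move/eqP=> p1; rewrite p1 in p_pr.
  have : p %| b * (j - i).
    rewrite (_ : b * _ = (b * j.+1).+1 - (b * i.+1).+1) ?dvdn_sub //.
    by rewrite subSS -mulnBr subSS.
  rewrite Euclid_dvdM // (negPf npb) /= => pji.
  case/negP: npb; apply: dvdn_fact; rewrite prime_gt0 //=.
  by apply: leq_trans (dvdn_leq _ pji) _; rewrite /N; lia.
exists a, b => k kn; rewrite /beta Ha // modn_small // ltnS.
apply: leq_trans (leq_pmulr _ _) => //.
have sN : s k <= N.
  by rewrite /N; apply: leq_trans (leq_addl _ _); apply: (leq_bigmax (Ordinal kn)).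
apply: leq_trans sN _; rewrite /b; case: (N) => // N'.
by rewrite factS leq_pmulr ?fact_gt0.
Qed.

(** Only the values of [s] up to [F e] matter, so the quantifier over functions becomes one over two
    beta parameters. The beta values get variables [y], [z] of their own, because beta is available
    only through its graph. *)
Lemma arithmetical_sequence P0 PS P1 F :
  arithmetical (fun e => P0 (e 0) (fun k => e k.+1)) ->
  arithmetical (fun e => PS (e 0) (e 1) (e 2) (fun k => e k.+3)) ->
  arithmetical (fun e => P1 (e 0) (fun k => e k.+1)) ->
  polynomial F ->
  arithmetical (fun e => exists s : nat -> nat, [/\ P0 (s 0) e,
    forall k, k < F e -> PS k (s k) (s k.+1) e & P1 (s (F e)) e]).
Proof.
have HK := arithmetical_fo => H0 HS H1 HF.
apply: (fo_ext HK (P := fun e => exists a b,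
  (exists y, y = beta a b 0 /\ P0 y e) /\
  ((forall k, k < F e -> exists y z, y = beta a b k /\
    (z = beta a b k.+1 /\ PS k y z e)) /\
  exists y, y = beta a b (F e) /\ P1 y e))).
  move=> e; split.
    case=> a [b [[_ [-> h0]] [hS [_ [-> h1]]]]]; exists (beta a b); split=> // k.
    by case/hS => _ [_ [-> [->]]].
  case=> s [h0 hS h1]; have [a [b Hs]] := beta_surj s (F e).+1.
  exists a, b; split; first by exists (s 0); rewrite Hs.
  split; last by exists (s (F e)); rewrite Hs.
  move=> k kF; exists (s k), (s k.+1).
  by rewrite (Hs k (leqW kF)) (Hs k.+1 kF); do 2!split=> //; apply: hS.
have V := poly_var; have C0 := poly_const 0.
do 2!apply: (fo_ex HK); apply: (fo_and HK); last apply: (fo_and HK).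
- apply: (fo_ex HK); apply: (fo_and HK); first exact: arithmetical_beta.
  exact: (fo_ren HK (fun k => if k is k'.+1 then k'.+3 else 0) H0).
- apply: (fo_all HK); apply: (fo_imp HK).
    by apply: arithmetical_lt => //; exact: (poly_ren (fun k => k.+3) HF).
  do 2!apply: (fo_ex HK); apply: (fo_and HK); first exact: arithmetical_beta.
  apply: (fo_and HK); first by apply: arithmetical_beta => //; apply: poly_succ.
  (* The environment now begins with [z], [y], [k], [b], [a]. *)
  exact: (fo_ren HK (fun k => match k with
    | 0 => 2 | 1 => 1 | 2 => 0 | k'.+3 => k'.+4.+1 end) HS).
- apply: (fo_ex HK); apply: (fo_and HK).
    by apply: arithmetical_beta => //; exact: (poly_ren (fun k => k.+3) HF).
  exact: (fo_ren HK (fun k => if k is k'.+1 then k'.+3 else 0) H1).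
Qed.

(** * Recursive functions and computable sets *)

Lemma reval_functional n (c : recfun n) : forall v y z,
  reval c v y -> reval c v z -> y = z.
Proof.
elim: c => {n} [||n i|k n g IHg h IHh|n f IHf g IHg|n f IHf] v y z /=.
- by move=> -> ->.
- by move=> -> ->.
- by move=> -> ->.
- case=> w Hw Hy [w' Hw']; suff <- : w = w' by apply: IHg Hy.
  by apply: functional_extensionality => i; apply: IHh (Hw i) (Hw' i).
- case=> s [s0 sS ->] [s' [s'0 s'S ->]].
  (* Beyond the recursion argument the two value sequences may differ. *)
  suff H k : k <= v ord0 -> s k = s' k by apply: H.
  elim: k => [_|k IH kv]; first exact: IHf s0 s'0.
  apply: (IHg _ _ _ (sS k kv)); rewrite (IH (ltnW kv)).
  exact: s'S.
(* At the lesser of two distinct values, [f] would return both zero and a successor. *)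
- case=> y0 yS [z0 zS]; case: (ltngtP y z) => //.
    by case/zS => x /(IHf _ _ _ y0).
  by case/yS => x /(IHf _ _ _ z0).
Qed.

Lemma poly_vcons n F (V : _ -> 'I_n -> nat) : polynomial F ->
  (forall i, polynomial (fun e => V e i)) ->
  forall i, polynomial (fun e => vcons (F e) (V e) i).
Proof. by move=> HF HV i; rewrite /vcons; case: (unlift ord0 i). Qed.

(** Composition quantifies over a vector of intermediate values, primitive recursion over a finite
    sequence, and minimization over the numbers below the result. Allowing polynomials as arguments
    and value lets the induction hypotheses apply under these quantifiers. *)
Lemma arithmetical_reval n (c : recfun n) : forall V Y,
  (forall i, polynomial (fun e => V e i)) -> polynomial Y ->
  arithmetical (fun e => reval c (V e) (Y e)).
Proof.
have HK := arithmetical_fo.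
elim: c => {n} [||n i|k n g IHg h IHh|n f IHf g IHg|n f IHf] V Y HV HY /=.
- exact: arithmetical_eq HY (poly_const 0).
- by apply: arithmetical_eq => //; apply: poly_succ.
- exact: arithmetical_eq.
- apply: (fo_ext HK (P := fun e => exists w : 'I_k -> nat,
    (forall i, reval (h i) (V e) (w i)) /\ reval g w (Y e))).
    by move=> e; split=> [[w []]|[w]]; exists w.
  apply: (fo_ex_vec HK); apply: (fo_and HK).
    apply: (fo_forall_ord HK) => i; apply: IHh; last exact: poly_var.
    by move=> l; exact: (poly_ren (addn k) (HV l)).
  by apply: IHg; [move=> i; apply: poly_var|exact: (poly_ren (addn k) HY)].
- have HT i : polynomial (fun e => vtail (V e) i) by apply: HV.
  apply: (arithmetical_sequence (P0 := fun y e => reval f (vtail (V e)) y)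
    (PS := fun k y z e => reval g (vcons k (vcons y (vtail (V e)))) z)
    (P1 := fun y e => Y e = y) (F := fun e => V e ord0)) => //.
  + by apply: IHf; [move=> i; exact: (poly_ren succn (HT i))|exact: poly_var].
  + apply: IHg; last exact: poly_var.
    do 2!(apply: poly_vcons; first exact: poly_var).
    by move=> i; exact: (poly_ren (fun k => k.+3) (HT i)).
  + by apply: arithmetical_eq; [exact: (poly_ren succn HY)|exact: poly_var].
- apply: (fo_and HK); first by apply: IHf (poly_const 0); apply: poly_vcons.
  apply: (fo_all HK); apply: (fo_imp HK).
    by apply: arithmetical_lt; [exact: poly_var|exact: (poly_ren succn HY)].
  apply: (fo_ex HK); apply: IHf; last exact/poly_succ/poly_var.
  apply: poly_vcons; first exact: poly_var.
  by move=> i; exact: (poly_ren (fun k => k.+2) (HV i)).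
Qed.

Lemma computable_set_arithmetical n (X : ('I_n -> nat) -> Prop) :
  computable_set X -> arithmetical (fun e => X (fun i => e i)).
Proof.
case=> c Hc; have HR := @arithmetical_reval n c (fun e i => e i) (fun _ => 1)
  (fun i => poly_var i) (poly_const 1).
apply: (fo_ext arithmetical_fo _ HR) => e; have [H1 H0] := Hc (fun i => e i).
split=> [H|] //; apply: NNPP => /H0 H'.
by have := reval_functional H H'.
Qed.

(** * Definability over the domain of a computable model *)

Definition arithmetical_on (D : pred nat) (P : (nat -> {x | D x}) -> Prop) :=
  exists2 Q, arithmetical Q & forall e, Q (fun k => val (e k)) <-> P e.

Lemma arithmetical_on_fo (D : pred nat) :
  arithmetical (fun e => D (e 0)) -> fo_class (@arithmetical_on D).
Proof.
have HK := arithmetical_fo => HD; split.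
- by move=> P Q PQ [P' HP' EP]; exists P' => // e; rewrite EP.
- by exists (fun _ => False) => //; apply: (fo_bot HK).
- move=> P Q [P' HP' EP] [Q' HQ' EQ]; exists (fun e => P' e -> Q' e).
    exact: (fo_imp HK).
  by move=> e; rewrite EP EQ.
(* Quantifiers are relativized to [D]; this is where [D] has to be arithmetical. *)
- move=> P [P' HP' EP]; exists (fun e => forall x, D x -> P' (scons x e)).
    apply: (fo_all HK); apply: (fo_imp HK) => //.
    by apply: (fo_ext HK _ HP') => e; rewrite scons_eta.
  have E e a : scons (val a) (fun k => val (e k)) =
      fun k => val ((scons a e : nat -> {x | D x}) k).
    by apply: functional_extensionality => -[].
  move=> e; split=> H.
    by move=> a; apply/(EP (scons a e)); rewrite -E; apply: H; apply: valP.
  by move=> x Dx; rewrite (E e (exist _ x Dx)); apply/EP; apply: H.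
- move=> P g [P' HP' EP]; exists (fun e => P' (fun k => e (g k))).
    exact: (fo_ren HK).
  by move=> e; rewrite EP.
- move=> x y; exists (fun e => e x = e y); first exact: (fo_eq HK).
  by move=> e; split=> [/val_inj|->].
Qed.

Lemma computable_model_sat (S : signature) (D : pred nat)
    (M : structure S {x | D x}) : computable_model M ->
  fo_class (@arithmetical_on D) /\
  forall p, arithmetical_on (fun e => sat M e p).
Proof.
case=> _ HD Hf HP.
have HK : fo_class (@arithmetical_on D).
  exact: arithmetical_on_fo (computable_set_arithmetical HD).
split=> //; apply: (fo_sat HK).
  move=> n f; have [c Hc] := Hf n f.
  (* Outside [D] the code may diverge or leave the domain; inside, functionality of [reval]
     identifies its graph with that of the interpreted symbol. *)
  exists (fun e : nat -> nat => reval c (fun i => e i) (e n)).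
    by apply: arithmetical_reval => *; apply: poly_var.
  move=> e; split=> [H|<-]; last exact: Hc.
  exact/val_inj/(reval_functional (Hc _) H).
move=> n R; exists (fun e : nat -> nat => exists2 a : 'I_n -> {x | D x},
  (forall i : 'I_n, e i = val (a i)) & pint M R a).
  exact: (computable_set_arithmetical (HP n R)).
move=> e; split=> [[a Ha]|H]; last by exists (fun i => e i).
congr (pint M R _); apply: functional_extensionality => i.
exact/val_inj/esym/Ha.
Qed.

(** By disjointness every arithmetical function symbol is new over [S], so [U] defines it by an
    [S]-formula, which the common expansion [N] evaluates as [M] does. Arithmetic has no predicate
    symbols. *)
Lemma joint_extension_sat S S' (i : embedding S S') (j : embedding arith S')
    T U A (M : structure S A) B K : fo_class K ->
  joint_definitional_extension i j T TA U -> corresponding_model i j U M B ->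
  (forall p, K (fun e => sat M e p)) -> forall p, K (fun e => sat B e p).
Proof.
move=> HK [Hij _ [_ _ HD] _] [N [HN HM HB]] HS; apply: (fo_sat HK) => // n f.
have [|D _ /(provable_sound HN) E] := HD n (emf j f).
  by case=> g Hg; apply: (Hij n g f).
apply: (fo_ext HK _ (HS D)) => e; rewrite HB.1 -(sat_reduct D HM).
by have /sat_iff /= := E e; tauto.
Qed.

(** * Nonstandard models of true arithmetic *)

Lemma corresponding_model_TA S S' (i : embedding S S') (j : embedding arith S')
    T U A (M : structure S A) B :
  joint_definitional_extension i j T TA U -> corresponding_model i j U M B ->
  is_model B TA.
Proof.
move=> [_ _ _ [HU _ _]] [N [HN _ HB]] p Hp e; rewrite -(sat_reduct p HB).
apply: provable_sound HN _ _; apply/HU; first exact: Hp.1.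
by exists [:: p]; [move=> q [<-|]|apply: nd_ax; left].
Qed.

Lemma teval_numeral_const A (B : structure arith A) n e e' :
  teval B e (numeral n) = teval B e' (numeral n).
Proof.
elim: n => [|n IH] /=.
  by congr (fint B _ _); apply: functional_extensionality; case.
congr (fint B _ _); apply: functional_extensionality => i.
case: eqP => // _ /=.
by congr (fint B _ _); apply: functional_extensionality; case.
Qed.

Definition eadd A (B : structure arith A) x y :=
  fint B (AAdd : Defs.fsym arith 2) (fun i => if i == ord0 then x else y).

Lemma teval_add A (B : structure arith A) e t u :
  teval B e (tadd t u) = eadd B (teval B e t) (teval B e u).
Proof. by congr (fint B _ _); apply: functional_extensionality => i; case: eqP. Qed.

(** Otherwise every element is the value of a numeral, and sending it to that number is an
    isomorphism: inequalities and sums and products of numerals transfer from the standard model. *)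
Lemma nonstandard_element A (B : structure arith A) (e : nat -> A) :
  is_model B TA -> nonstandard B -> exists k, forall n, k <> teval B e (numeral n).
Proof.
move=> HB nst; apply: NNPP => H; apply: nst.
have /functional_choice [h hK] : forall a, exists n, teval B e (numeral n) = a.
  by move=> a; apply: NNPP => Ha; apply: H; exists a => n an; apply: Ha; exists n.
have gK n : h (teval B e (numeral n)) = n.
  apply/eqP/negPn/negP => /eqP ne.
  have H' : holds standard_model
      (Neg (Eq (numeral (h (teval B e (numeral n)))) (numeral n))).
    by move=> e' /=; rewrite !teval_numeral.
  by apply: (TA_model_holds HB H' e); rewrite /= hK.
exists h; split; last by move=> n [].
  by exists (fun n => teval B e (numeral n)).
have tr t s : holds standard_model (Eq t s) -> teval B e t = teval B e s.
  by move/(TA_model_holds HB)/(_ e).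
have E2 (a : 'I_2 -> A) : a = fun i => if i == ord0 then a ord0 else a ord_max.
  apply: functional_extensionality => i; case: eqP => [->//|].
  by move=> Hi; congr a; apply: val_inj; case: i Hi => -[|[]] // l [] ; apply: val_inj.
move=> n [] a.
- have -> : fint B (AZero : Defs.fsym arith 0) a = teval B e (numeral 0).
    by congr (fint B _ _); apply: functional_extensionality; case.
  by rewrite gK.
- have -> : fint B (AOne : Defs.fsym arith 0) a = teval B e tone.
    by congr (fint B _ _); apply: functional_extensionality; case.
  by rewrite (tr tone (numeral 1)) ?gK.
- have -> : fint B (AAdd : Defs.fsym arith 2) a =
      teval B e (numeral (h (a ord0) + h (a ord_max))).
    rewrite -(tr (tadd (numeral (h (a ord0))) (numeral (h (a ord_max))))).
      by rewrite teval_add !hK {1}(E2 a).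
    by move=> e'; rewrite /= !teval_numeral.
  by rewrite gK.
- have -> : fint B (AMul : Defs.fsym arith 2) a =
      teval B e (numeral (h (a ord0) * h (a ord_max))).
    rewrite -(tr (tmul (numeral (h (a ord0))) (numeral (h (a ord_max))))).
      rewrite {1}(E2 a) /=; congr (fint B _ _).
      by apply: functional_extensionality => l; case: eqP; rewrite hK.
    by move=> e'; rewrite /= !teval_numeral.
  by rewrite gK.
Qed.

(** Induction on [n]: if [k = n + z] and [k] differs from [n], then [z] has a predecessor, which
    serves for [n + 1]. This implication holds in the standard model and is transferred. *)
Lemma nonstandard_element_ge A (B : structure arith A) e k :
  is_model B TA -> (forall n, k <> teval B e (numeral n)) ->
  forall n, exists z, k = eadd B (teval B e (numeral n)) z.
Proof.
move=> HB nk; elim=> [|n [z kz]].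
  exists k.
  have H : holds standard_model (Eq (Var 0) (tadd (numeral 0) (Var 0))) by [].
  have := TA_model_holds HB H (scons k e); rewrite /sat teval_add.
  by rewrite (teval_numeral_const B 0 (scons k e) e).
pose q := Eq (Var 1) (tadd (numeral n.+1) (Var 0)).
have H : holds standard_model (Imp (Eq (Var 0) (tadd (numeral n) (Var 1)))
    (Imp (Neg (Eq (Var 0) (numeral n))) (Ex q))).
  move=> e' E1 E2; apply/(sat_ex _ e' q); exists (e' 1).-1.
  move: E1 E2; rewrite /= !teval_numeral.
  by case: (e' 1) => [|m] -> /=; lia.
have E := teval_numeral_const B.
have /sat_ex [z'] : sat B (scons k (scons z e)) (Ex q).
  apply: (TA_model_holds HB H).
    by rewrite /sat teval_add (E _ _ e).
  by rewrite /= (E _ _ e); apply: nk.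
by rewrite /q /sat teval_add (E _ _ e) => Hz; exists z'.
Qed.

(** The values of the numerals arise by iterating the successor of [B], whose graph is arithmetical,
    so a sequence of such steps starting from the zero of [B] defines them. *)
Lemma arithmetical_on_numeral (D : pred nat) (B : structure arith {x | D x}) e0 :
  arithmetical (fun e => D (e 0)) ->
  (forall p, arithmetical_on (fun e => sat B e p)) ->
  arithmetical (fun e => e 1 = val (teval B e0 (numeral (e 0)))).
Proof.
move=> HD HB; have HK := arithmetical_fo.
have [Q HQ EQ] := HB (Eq (tadd (Var 0) tone) (Var 1)).
pose c n := teval B e0 (numeral n).
have Qc n y : Q (fun k => if k is 0 then val (c n) else val y) <-> y = c n.+1.
  have := EQ (fun k => if k is 0 then c n else y).
  rewrite (_ : (fun k => val _) = fun k => if k is 0 then val (c n) else val y);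
    last by apply: functional_extensionality => -[].
  move=> ->; rewrite /sat /c [numeral n.+1]/= !teval_add.
  have -> : forall e, teval B e tone = teval B e0 tone.
    by move=> e; congr (fint B _ _); apply: functional_extensionality; case.
  by split=> ->.
apply: (fo_ext HK _ (arithmetical_sequence
  (P0 := fun y e => y = val (c 0))
  (* [Q] describes the successor of [B] only on elements of the domain, whence the condition
     [D z]. *)
  (PS := fun k y z e => D z /\ Q (fun k => if k is 0 then y else z))
  (P1 := fun y e => e 1 = y) (F := fun e => e 0) _ _ _ _)).
- move=> e; split=> [[s [s0 sS ->]]|->].
    suff H k : k <= e 0 -> s k = val (c k) by apply: H.
    elim: k => [//|k IH ke]; have [Dk] := sS k ke.
    by rewrite (IH (ltnW ke)) => /(Qc k (exist _ (s k.+1) Dk)) <-.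
  exists (fun n => val (c n)); split=> // k _; split; first exact: valP.
  exact/Qc.
- by apply: arithmetical_eq; [exact: poly_var|exact: poly_const].
- apply: (fo_and HK); first exact: (fo_ren HK (fun=> 2) HD).
  apply: (arithmetical_subst (F := fun e k => if k is 0 then e 1 else e 2) HQ).
  by move=> [|k]; apply: poly_var.
- exact: (fo_eq HK).
- exact: poly_var.
Qed.

(* In the standard model, the set defined by [phi] has a beta-code below any
   bound [k]; the same sentence gives a code in [B] below the nonstandard [k],
   which lies above all numerals. *)
Lemma nonstandard_code A (B : structure arith A) e0 k phi psi :
  is_model B TA -> (forall n, k <> teval B e0 (numeral n)) ->
  (forall e, sat standard_model e psi <-> 0 = beta (e 1) (e 2) (e 0)) ->
  exists a b, forall n, sat standard_model (fun _ => n) phi <->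
    sat B (fun i => match i with
      | 0 => teval B e0 (numeral n) | 1 => a | _ => b end) psi.
Proof.
move=> HB nk Hpsi.
(* The free variable is the bound [k]. Under the quantifiers over [a], [b], [x], [z] these are
   [Var 3] down to [Var 0] and [k] is [Var 4]; the premise [k = x + z] says that [x] is at most
   [k]. *)
pose chi := Ex (Ex (All (All (Imp (Eq (Var 4) (tadd (Var 1) (Var 0)))
  (Iff (fsubst (fun _ => Var 1) phi)
    (fsubst (fun i => match i with 0 => Var 1 | 1 => Var 3 | _ => Var 2 end)
      psi)))))).
have Hchi : holds standard_model chi.
  move=> e.
  have /functional_choice [s Hs] : forall n, exists m,
      sat standard_model (fun _ => n) phi <-> 0 = m.
    by move=> n; have [H|H] := classic (sat standard_model (fun _ => n) phi);
      [exists 0|exists 1].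
  (* The length is [k + 1] since [x = k] is included. *)
  have [a [b Hab]] := beta_surj s (e 0).+1.
  apply/sat_ex; exists a; apply/sat_ex; exists b => x z E.
  apply/sat_iff; rewrite !sat_subst Hpsi /= Hab ?Hs //.
  by move: E => /= ->; rewrite ltnS leq_addr.
have /sat_ex [a /sat_ex [b H]] := TA_model_holds HB Hchi (fun _ => k).
exists a, b => n; have [z kz] := nonstandard_element_ge HB nk n.
pose c := teval B e0 (numeral n).
pose e1 := scons z (scons c (scons b (scons a (fun _ => k)))).
have kz' : teval B e1 (Var 4) = teval B e1 (tadd (Var 1) (Var 0)).
  by rewrite teval_add.
have /sat_iff := H c z kz'; rewrite !sat_subst /=.
rewrite (_ : (fun i => teval B _ _) = fun i => match i with
  | 0 => c | 1 => a | _ => b end); last first.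
  by apply: functional_extensionality => -[|[]].
move=> <-; have Hn p : holds standard_model (fsubst (fun _ => numeral n) p) ->
    sat B (fun _ => teval B e0 (numeral n)) p.
  by move/(TA_model_holds HB)/(_ e0)/sat_subst.
have E e : (fun _ : nat => teval standard_model e (numeral n)) = fun _ => n.
  by apply: functional_extensionality => i; rewrite teval_numeral.
(* Either [phi] or its negation holds at [n] in the standard model, and whichever holds transfers to
   the numeral in [B]. *)
have [Hp|Hp] := classic (sat standard_model (fun _ => n) phi); split=> // Hq.
  by apply: Hn => e; apply/sat_subst; rewrite E.
suff : sat B (fun _ => c) (Neg phi) by move/(_ Hq).
by apply: Hn => e /= /sat_subst; rewrite E.
Qed.

(** * Diagonalization *)

Lemma pairing_inj x y x' y' :
  (x + y) * (x + y) + x = (x' + y') * (x' + y') + x' -> x = x' /\ y = y'.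
Proof.
(* For a sum [s] and [x <= s], the number [s * s + x] lies below [(s + 1) * (s + 1)], so it
   determines [s] and then [x]. *)
move=> H; suff E : x + y = x' + y' by move: H; rewrite E; lia.
by case: (ltngtP (x + y) (x' + y')) => // /(fun lt => leq_mul lt lt); lia.
Qed.

Theorem theorem18 :
  ~ exists (S S' : signature) (i : embedding S S') (j : embedding arith S')
           (T : theory S) (U : theory S') (D : pred nat)
           (M : structure S {x : nat | D x})
           (A : structure arith {x : nat | D x}),
      [/\ joint_definitional_extension i j T TA U,
          computable_model M,
          is_model M T,
          corresponding_model i j U M A
        & nonstandard A].
Proof.
case=> S [S' [i [j [T [U [D [M [A [HU HM _ HA nst]]]]]]]]].
have HK := arithmetical_fo; have [HKD HMsat] := computable_model_sat HM.
have HAsat := joint_extension_sat HKD HU HA HMsat.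
have HTA := corresponding_model_TA HU HA.
have HD : arithmetical (fun e => D (e 0)).
  by case: HM => _ /computable_set_arithmetical.
have [e0] : inhabited (nat -> {x | D x}) by case: (nonempty A) => x; split.
have [k nk] := nonstandard_element e0 HTA nst.
have [psi Hpsi] := arithmetical_beta (poly_const 0) (poly_var 1) (poly_var 2) (poly_var 0).
have [R HR ER] := HAsat psi.
(* The diagonal set: [m] is a pair code and, by [R], the pair read as beta parameters in [A] does
   not put the numeral [m] into the coded set. The variable [u] is needed since the value of the
   numeral is known only by its graph. *)
pose X m := exists x y, m = (x + y) * (x + y) + x /\
  ~ exists u, u = val (teval A e0 (numeral m)) /\
    R (fun k => match k with 0 => u | 1 => x | _ => y end).
have [phi Hphi] : arithmetical (fun e => X (e 0)).
  do 2!apply: (fo_ex HK); apply: (fo_and HK).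
    by apply: arithmetical_eq; do ?[exact: poly_var|apply: poly_add|apply: poly_mul].
  apply: (fo_not HK); apply: (fo_ex HK); apply: (fo_and HK).
    exact: (fo_ren HK (fun k => if k is 0 then 3 else 0)
      (arithmetical_on_numeral e0 HD HAsat)).
  apply: (arithmetical_subst (F := fun e k =>
    match k with 0 => e 0 | 1 => e 2 | _ => e 1 end) HR).
  by move=> [|[|k']]; apply: poly_var.
have [a [b Hab]] := nonstandard_code phi HTA nk Hpsi.
(* Elements of [A] are naturals, so the code of [X] itself has a pair code [m]; membership of [m] in
   [X] contradicts itself. *)
pose m := (val a + val b) * (val a + val b) + val a.
have := Hab m; rewrite Hphi -ER.
rewrite (_ : (fun k => val _) = fun k => match k with
  | 0 => val (teval A e0 (numeral m)) | 1 => val a | _ => val b end); last first.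
  by apply: functional_extensionality => -[|[]].
set Q := R _ => XQ.
have nXQ : X m <-> ~ Q.
  split=> [[x [y [E nR]]] HQ|nQ]; last first.
    by exists (val a), (val b); split=> // -[u [->]].
  have [xa yb] := @pairing_inj (val a) (val b) x y E.
  by apply: nR; exists (val (teval A e0 (numeral m))); rewrite -xa -yb.
by tauto.
Qed.
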